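(* Let $K$ be a field, $S=K[x_1,\ldots,x_n]$, let $I$ be a squarefree monomial ideal of $S$ and let $\mathbf{a}\in\mathbb{Z}_{>0}^n$. Suppose that $I^{[\mathbf{a}]}$ is componentwise linear. Then $I$ is componentwise linear.
   Context: $S=K[x_1,\ldots,x_n]$ is the polynomial ring in $n$ variables over a field $K$ with the standard grading $\deg x_1=\cdots=\deg x_n=1$. For a monomial ideal $I$ of $S$, $G(I)$ denotes its unique minimal set of monomial generators. For $\mathbf{a}=(a_1,\ldots,a_n)\in\mathbb{Z}_{>0}^n$ and a squarefree monomial $u=x_{i_1}\cdots x_{i_d}$ with $1\le i_1<\cdots<i_d\le n$, set $u^{[\mathbf{a}]}:=x_{i_1}^{a_{i_1}}\cdots x_{i_d}^{a_{i_d}}$. For a squarefree monomial ideal $I$ of $S$, $I^{[\mathbf{a}]}$ is the monomial ideal with $G(I^{[\mathbf{a}]})=\{u^{[\mathbf{a}]} : u\in G(I)\}$. For a homogeneous ideal $I$ of $S$ and an integer $j$, $I_{\langle j\rangle}$ denotes the ideal of $S$ generated by all homogeneous polynomials of degree $j$ belonging to $I$. The ideal $I$ is componentwise linear if $I_{\langle j\rangle}$ has a linear resolution for all $j$ (with the usual convention that the zero ideal has a linear resolution). An ideal $L$ generated by homogeneous elements of a single degree $d$ has a linear resolution if its graded Betti numbers satisfy $\beta_{p,q}(L)=\dim_K \operatorname{Tor}_p^S(K,L)_q=0$ whenever $q\ne p+d$. *)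

(* Defs.v *)
From HB Require Import structures.
From mathcomp Require Import all_boot all_order all_algebra.
From mathcomp.multinomials Require Import mpoly.
Set Implicit Arguments. Unset Strict Implicit. Unset Printing Implicit Defensive.
Import GRing.Theory.
Local Open Scope ring_scope.

Section Ideals.
Variables (K : fieldType) (n : nat).
Local Notation S := {mpoly K[n]}.

(* Ideals of S are predicates S -> Prop, compared by <->. *)
Definition ideal_gen (G : S -> Prop) : S -> Prop := fun f =>
  exists2 s : seq (S * S), (forall t, t \in s -> G t.2)
                         & f = \sum_(t <- s) t.1 * t.2.

(* Monomials are identified with their exponent vectors in 'X_{1..n}. *)
Definition monomial_ideal_gen (G : 'X_{1..n} -> Prop) : S -> Prop :=
  ideal_gen (fun f => exists2 u, G u & f = 'X_[u]).

Definition monomial_generators (I : S -> Prop) (G : 'X_{1..n} -> Prop) : Prop :=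
  forall f, I f <-> monomial_ideal_gen G f.

Definition minimal_monomial_generators
    (I : S -> Prop) (G : 'X_{1..n} -> Prop) : Prop :=
  monomial_generators I G /\
  forall G' : 'X_{1..n} -> Prop, (forall u, G' u -> G u) ->
    monomial_generators I G' -> forall u, G u -> G' u.

(* G(I); a monomial ideal has exactly one minimal set of monomial
   generators, so the existential selects the members of that set. *)
Definition min_gens (I : S -> Prop) : 'X_{1..n} -> Prop := fun u =>
  exists2 G, minimal_monomial_generators I G & G u.

Definition squarefree (u : 'X_{1..n}) : Prop := forall i, (u i <= 1)%N.

Definition squarefree_monomial_ideal (I : S -> Prop) : Prop :=
  exists2 G : 'X_{1..n} -> Prop,
    (forall u, G u -> squarefree u) & monomial_generators I G.

(* u^[a]: the product of the x_i ^ a_i over the i such that x_i divides u. *)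
Definition bracket_monomial (a : 'I_n -> nat) (u : 'X_{1..n}) : 'X_{1..n} :=
  [multinom (if (0 < u i)%N then a i else 0%N) | i < n].

Definition bracket_ideal (I : S -> Prop) (a : 'I_n -> nat) : S -> Prop :=
  monomial_ideal_gen
    (fun v => exists2 u, min_gens I u & v = bracket_monomial a u).

(* I_<j>.  Every polynomial in I_<j> vanishes for j < 0, so j : nat suffices. *)
Definition component (I : S -> Prop) (j : nat) : S -> Prop :=
  ideal_gen (fun f => I f /\ f \is j.-homog).

End Ideals.

Section Tor.
Variables (K : fieldType) (n : nat).
Local Notation S := {mpoly K[n]}.

(* Degree q part of the free graded module with basis e_0, ..., e_(r-1),
   deg e_j = sh j; row vectors are coordinates in that basis. *)
Definition homog_row (r : nat) (sh : 'I_r -> int) (q : int)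
    (v : 'rV[S]_r) : Prop :=
  forall j m, m \in msupp (v 0 j) -> (mdeg m)%:Z + sh j = q.

(* A graded free resolution ... -> P_1 -> P_0 -> K -> 0 of K = S/(x_1,...,x_n)
   by finitely generated free modules.  P_p is 'rV[S]_(rank p) with basis in
   degrees shift p; maps act on row vectors by right multiplication.  aug lists
   the images in K of the basis of P_0, and S acts on K through the constant
   coefficient f@_0. *)
Record free_resolution := FreeResolution {
  rank : nat -> nat;
  shift : forall p, 'I_(rank p) -> int;
  diff : forall p, 'M[S]_(rank p.+1, rank p);
  aug : 'cV[K]_(rank 0);
  diff_homog : forall p i, homog_row (@shift p) (shift i) (row i (diff p));
  aug_homog : forall j, aug j 0 != 0 -> shift j = 0;
  aug_surj : aug != 0;
  aug_exact : forall v : 'rV[S]_(rank 0),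
    \sum_j (v 0 j)@_0%MM * aug j 0 = 0 <-> exists w, v = w *m diff 0;
  diff_exact : forall p (v : 'rV[S]_(rank p.+1)),
    v *m diff p = 0 <-> exists w, v = w *m diff p.+1
}.

(* P_p (x)_S L is the module of row vectors with entries in L. *)
Definition tensor_row (P : free_resolution) (L : S -> Prop) (p : nat) (q : int)
    (v : 'rV[S]_(rank P p)) : Prop :=
  (forall j, L (v 0 j)) /\ homog_row (@shift P p) q v.

Definition in_kernel (P : free_resolution) (p : nat) :
    'rV[S]_(rank P p) -> Prop :=
  match p with
  | 0 => fun=> True
  | p'.+1 => fun v => v *m diff P p' = 0
  end.

Definition tor_cycle (P : free_resolution) (L : S -> Prop) (p : nat) (q : int)
    (v : 'rV[S]_(rank P p)) : Prop :=
  tensor_row L q v /\ in_kernel v.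

Definition tor_boundary (P : free_resolution) (L : S -> Prop) (p : nat)
    (q : int) (v : 'rV[S]_(rank P p)) : Prop :=
  exists2 w : 'rV[S]_(rank P p.+1), tensor_row L q w & v = w *m diff P p.

(* dim_K H_p(P (x) L)_q = b: the classes of some cycles c_0, ..., c_(b-1)
   form a basis. *)
Definition tor_dim (P : free_resolution) (L : S -> Prop) (p : nat) (q : int)
    (b : nat) : Prop :=
  exists2 c : 'I_b -> 'rV[S]_(rank P p),
    (forall i, tor_cycle L q (c i)) &
    forall z, tor_cycle L q z ->
      exists! t : 'rV[K]_b, tor_boundary L q (z - \sum_i (t 0 i)%:MP *: c i).

(* beta_(p,q)(L) = dim_K Tor_p^S(K, L)_q = b.  The dimension does not depend on
   the resolution P of K, and resolutions exist (the Koszul complex). *)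
Definition graded_betti (L : S -> Prop) (p : nat) (q : int) (b : nat) : Prop :=
  forall P : free_resolution, tor_dim P L p q b.

Definition generated_in_degree (d : nat) (L : S -> Prop) : Prop :=
  exists2 G : S -> Prop, (forall g, G g -> g \is d.-homog)
                       & forall f, L f <-> ideal_gen G f.

(* d is unique when L <> 0; the zero ideal satisfies this for every d. *)
Definition has_linear_resolution (L : S -> Prop) : Prop :=
  exists2 d : nat, generated_in_degree d L &
    forall (p : nat) (q : int), q <> (p + d)%:Z -> graded_betti L p q 0.

Definition componentwise_linear (I : S -> Prop) : Prop :=
  forall j : nat, has_linear_resolution (component I j).

End Tor.

(* Main.v *)
Require Import Defs.
From mathcomp Require Import all_boot all_order all_algebra.
From mathcomp.multinomials Require Import mpoly.
From mathcomp Require Import boolp zify.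
Set Implicit Arguments. Unset Strict Implicit. Unset Printing Implicit Defensive.
Import GRing.Theory.
Local Open Scope ring_scope.

(** Write J_{<=k} for the ideal generated by the monomials of degree at most k
    in J. As Tor_p(M)_q vanishes whenever M_(q-p) = 0, a monomial ideal J is
    componentwise linear iff Tor_p(J_{<=k})_q = 0 for all k and q > p + k.

    The exponents a_i are changed to 1 one at a time. Let x = x_i, e = a_i, and
    write J_{<=k} = A_k + x^e B_{k-e} with A_k and B_r generated by monomials
    prime to x. Since x kills Tor, Tor(A_k) embeds into Tor(J_{<=k}), so the
    condition on J gives Tor_p(A_k)_q = 0 for q > p + k, and, after a shift by e,
    Tor_p(B_r / (B_r :&: A_{r+e}))_q = 0 for q > p + r. For p = 1 the latter
    says that the relations of B_r / (B_r :&: A_{r+e}) have degree at most r + 1;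
    by Nakayama B_r :&: A_{r+e} = B_r :&: A_{r+1}, and the condition follows for
    the ideal with components A_k + x B_{k-1}.

    Tor is computed from one fixed resolution of K throughout. *)

(** * Supports of rows of polynomials *)

Section RowSupport.
Variables (K : fieldType) (n : nat).
Local Notation S := {mpoly K[n]}.
Local Notation mon := 'X_{1..n}.
Implicit Types (f g : S) (u m : mon) (D E : mon -> Prop).

(** Monomial ideals are handled through the set of exponents of their monomials, and such a set is
    closed under adding exponents. *)
Definition up_closed D := forall u m, D u -> D (u + m)%MM.

(** The set depends on the coordinate [j] so that homogeneity, where the degree of [e_j] enters, is
    a support condition like membership in an ideal. *)
Definition row_supp r (G : 'I_r -> mon -> Prop) (v : 'rV[S]_r) :=
  forall j m, m \in msupp (v 0 j) -> G j m.

Definition supp_in r D (v : 'rV[S]_r) := row_supp (fun=> D) v.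

Lemma row_suppW r (G H : 'I_r -> mon -> Prop) v :
  (forall j m, G j m -> H j m) -> row_supp G v -> row_supp H v.
Proof. by move=> GH Gv j m /Gv/GH. Qed.

Lemma row_supp0 r (G : 'I_r -> mon -> Prop) : row_supp G 0.
Proof. by move=> j m; rewrite mxE msupp0. Qed.

Lemma row_suppD r (G : 'I_r -> mon -> Prop) v w :
  row_supp G v -> row_supp G w -> row_supp G (v + w).
Proof.
move=> Gv Gw j m; rewrite mxE => /msuppD_le; rewrite mem_cat.
by case/orP=> [/Gv|/Gw].
Qed.

Lemma row_suppB r (G : 'I_r -> mon -> Prop) v w :
  row_supp G v -> row_supp G w -> row_supp G (v - w).
Proof.
move=> Gv Gw j m; rewrite !mxE => /msuppB_le; rewrite mem_cat.
by case/orP=> [/Gv|/Gw].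
Qed.

Lemma row_supp_eq0 r (v : 'rV[S]_r) : row_supp (fun _ _ => False) v -> v = 0.
Proof.
move=> v0; apply/rowP => j; rewrite mxE; apply/eqP; rewrite -msupp_eq0.
by case E: (msupp _) => [|m s] //; case: (v0 j m); rewrite E mem_head.
Qed.

Lemma mcoeffXM u m f : ('X_[u] * f)@_(u + m) = f@_m.
Proof. by rewrite -commr_mpolyX mcoeffMX. Qed.

Lemma msuppXM u f m :
  reflect (exists2 k, k \in msupp f & m = (u + k)%MM) (m \in msupp ('X_[u] * f)).
Proof.
rewrite -commr_mpolyX (perm_mem (msuppMX _ _)).
by apply: (iffP mapP) => -[k kf ->]; exists k.
Qed.

Lemma row_suppXM r (G : 'I_r -> mon -> Prop) u v :
  row_supp G ('X_[u] *: v) <-> row_supp (fun j m => G j (u + m)%MM) v.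
Proof.
split=> Gv j m.
  by move=> mv; apply: Gv; rewrite mxE; apply/msuppXM; exists m.
by rewrite mxE => /msuppXM[k /Gv ? ->].
Qed.

Lemma supp_in_divX r D u (v : 'rV[S]_r) :
  (forall m, D (u + m)%MM -> D m) -> supp_in D ('X_[u] *: v) -> supp_in D v.
Proof. by move=> Du /row_suppXM; apply: row_suppW => _; exact: Du. Qed.

(** The quantifier over [G] lets a single splitting keep every support condition known of [v], such
    as lying over an ideal and being homogeneous. *)
Lemma row_supp_split r (Q : 'I_r -> mon -> Prop) (v : 'rV[S]_r) :
  exists v1 v2, [/\ v = v1 + v2,
    forall G, row_supp G v -> row_supp (fun j m => G j m /\ Q j m) v1 &
    forall G, row_supp G v -> row_supp (fun j m => G j m /\ ~ Q j m) v2].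
Proof.
pose sel (b : 'I_r -> pred mon) : 'rV[S]_r :=
  \row_j \sum_(m <- msupp (v 0 j) | b j m) (v 0 j)@_m *: 'X_[m].
have supp_sel (b : 'I_r -> pred mon) (G : 'I_r -> mon -> Prop) :
    row_supp G v -> row_supp (fun j m => G j m /\ b j m) (sel b).
  move=> Gv j m; rewrite mxE => /msupp_sum_le/flattenP[s /mapP[k]].
  rewrite mem_filter => /andP[bk kv] -> /msuppZ_le/mem_msuppXP <-.
  by split; first exact: Gv.
exists (sel (fun j m => `[< Q j m >])), (sel (fun j m => ~~ `[< Q j m >])).
split=> [|G Gv|G Gv].
- apply/rowP => j; rewrite !mxE [LHS]mpolyE.
  by rewrite (bigID (fun m => `[< Q j m >])).
- by apply: row_suppW (supp_sel _ _ Gv) => j m [? /asboolP].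
- by apply: row_suppW (supp_sel _ _ Gv) => j m [? /asboolPn].
Qed.

Lemma row_suppXM_ex r u (v : 'rV[S]_r) :
  supp_in (fun m => (u <= m)%MM) v -> exists v', v = 'X_[u] *: v'.
Proof.
move=> uv; exists (\row_j \sum_(m <- msupp (v 0 j)) (v 0 j)@_m *: 'X_[m - u]).
apply/rowP => j; rewrite !mxE [LHS]mpolyE mulr_sumr.
apply: eq_big_seq => m /uv um.
by rewrite -scalerAr -mpolyXD addmC submK.
Qed.

Lemma supp_in_mul r s D (A : 'M[S]_(r, s)) v :
  up_closed D -> supp_in D v -> supp_in D (v *m A).
Proof.
move=> uD Dv j m; rewrite mxE => /msupp_sum_le/flattenP[t /mapP[i _ ->]].
case/msuppM_le/allpairsP => -[m1 m2] /= [/Dv Dm1 _ ->]; exact: uD.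
Qed.

Lemma mnm_le_up u m : (u <= u + m)%MM.
Proof. by apply/mnm_lepP => i; rewrite mnmDE leq_addr. Qed.

Lemma mnm_le_mdeg_eq u m : (m <= u)%MM -> (mdeg u <= mdeg m)%N -> m = u.
Proof.
move=> mu; rewrite -{1 2}(submK mu) mdegD => h.
by have /eqP : mdeg (u - m) = 0%N by [lia]; rewrite mdeg_eq0 => /eqP->; rewrite add0m.
Qed.

Lemma not_le_up u : up_closed (fun m => ~ (m <= u)%MM).
Proof. by move=> k m nk ku; apply: nk; exact: lepm_trans (mnm_le_up _ _) ku. Qed.

End RowSupport.

(** * Vanishing of Tor for quotients of monomial ideals *)

Section TorVanishing.
Variables (K : fieldType) (n : nat) (P : free_resolution K n).
Local Notation S := {mpoly K[n]}.
Local Notation mon := 'X_{1..n}.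
Local Notation d := (diff P).
Implicit Types (f g : S) (u m : mon) (D E F : mon -> Prop) (p : nat) (q : int).

(** With an arbitrary [Q], one lemma shows that differentials preserve both the terms of degree [q]
    and those of degree other than [q]. *)
Definition graded_supp (Q : int -> Prop) p (v : 'rV[S]_(rank P p)) :=
  row_supp (fun j m => Q ((mdeg m)%:Z + shift j)) v.

Definition hdeg q p (v : 'rV[S]_(rank P p)) := homog_row (@shift K n P p) q v.

Definition bd_supp E p : 'rV[S]_(rank P p) -> Prop :=
  match p with
  | 0 => fun=> True
  | p'.+1 => fun v => supp_in E (v *m d p')
  end.

(* The vanishing of the degree q part of H_p(P (x) D/E), where D and E stand
   for the monomial ideals they span. *)
Definition tor_vanish D E p q := forall z : 'rV[S]_(rank P p),
  supp_in D z -> hdeg q z -> bd_supp E z ->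
  exists w : 'rV[S]_(rank P p.+1),
    [/\ supp_in D w, hdeg q w & supp_in E (z - w *m d p)].

Lemma graded_supp_mul Q p (w : 'rV[S]_(rank P p.+1)) :
  graded_supp Q w -> graded_supp Q (w *m d p).
Proof.
move=> Qw j m; rewrite mxE => /msupp_sum_le/flattenP[t /mapP[i _ ->]].
case/msuppM_le/allpairsP => -[m1 m2] /= [/Qw Qm1 m2d ->].
have := @diff_homog _ _ P p i j m2; rewrite mxE => /(_ m2d) sh.
by rewrite mdegD PoszD -addrA sh.
Qed.

Lemma hdeg_mul q p (w : 'rV[S]_(rank P p.+1)) : hdeg q w -> hdeg q (w *m d p).
Proof. exact: (@graded_supp_mul (fun k => k = q)). Qed.

Lemma hdegB q p (v w : 'rV[S]_(rank P p)) :
  hdeg q v -> hdeg q w -> hdeg q (v - w).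
Proof. exact: row_suppB. Qed.

Lemma hdegXM q u p (v : 'rV[S]_(rank P p)) :
  hdeg q ('X_[u] *: v) <-> hdeg (q - (mdeg u)%:Z) v.
Proof.
rewrite /hdeg /homog_row -/(row_supp _ _) row_suppXM.
by split; apply: row_suppW => j m; rewrite mdegD; lia.
Qed.

Lemma diffK p (v : 'rV[S]_(rank P p.+2)) : v *m d p.+1 *m d p = 0.
Proof. by apply/diff_exact; exists v. Qed.

Lemma bd_supp_diff E p (w : 'rV[S]_(rank P p.+1)) : bd_supp E (w *m d p).
Proof. by case: p w => [//|p] w; rewrite /= diffK; exact: row_supp0. Qed.

Lemma bd_suppB E p (v w : 'rV[S]_(rank P p)) :
  bd_supp E v -> bd_supp E w -> bd_supp E (v - w).
Proof. by case: p v w => [//|p] v w; rewrite /= mulmxBl; exact: row_suppB. Qed.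

Lemma bd_suppW D E p (v : 'rV[S]_(rank P p)) :
  (forall m, D m -> E m) -> bd_supp D v -> bd_supp E v.
Proof. by case: p v => [//|p] v DE; apply: row_suppW => _; exact: DE. Qed.

Lemma supp_bd E p (v : 'rV[S]_(rank P p)) :
  up_closed E -> supp_in E v -> bd_supp E v.
Proof. by case: p v => [//|p] v; exact: supp_in_mul. Qed.

Lemma bd_suppXM E u p (v : 'rV[S]_(rank P p)) :
  bd_supp E ('X_[u] *: v) <-> bd_supp (fun m => E (u + m)%MM) v.
Proof. by case: p v => [//|p] v; rewrite /= -scalemxAl; exact: row_suppXM. Qed.

Lemma bd_supp_divX E u p (v : 'rV[S]_(rank P p)) :
  (forall m, E (u + m)%MM -> E m) -> bd_supp E ('X_[u] *: v) -> bd_supp E v.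
Proof. by move=> Eu /bd_suppXM; exact: bd_suppW. Qed.

(** Differentials preserve degree, so the degree [q] part of a bounding chain of [z] still bounds
    it. Bounding chains can thus be built without regard to homogeneity. *)
Lemma hdeg_lift D E p q (z : 'rV[S]_(rank P p)) (w : 'rV[S]_(rank P p.+1)) :
  hdeg q z -> supp_in D w -> supp_in E (z - w *m d p) ->
  exists w', [/\ supp_in D w', hdeg q w' & supp_in E (z - w' *m d p)].
Proof.
move=> qz Dw Ezw.
have [w1 [w2 [ew s1 s2]]] := row_supp_split (fun j m => (mdeg m)%:Z + shift j = q) w.
have qw1 : hdeg q w1 by apply: row_suppW (s1 _ Dw) => j m [].
exists w1; split; [by apply: row_suppW (s1 _ Dw) => j m []|exact: qw1|].
have nq : graded_supp (fun k => k <> q) (w2 *m d p).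
  by apply: graded_supp_mul; apply: row_suppW (s2 _ Dw) => j m [].
move=> j m mzw; apply: (Ezw j m).
have qm := hdegB qz (hdeg_mul qw1) mzw.
have /memN_msupp_eq0 w20 : m \notin msupp ((w2 *m d p) 0 j) by apply/negP => /nq.
have {}w20 : ((- (w2 *m d p)) 0 j)@_m = 0 by rewrite mxE mcoeffN w20 oppr0.
by rewrite ew mulmxDl opprD addrA mcoeff_msupp mxE mcoeffD w20 addr0 -mcoeff_msupp.
Qed.

(** Exactness of Tor_p(E/F) -> Tor_p(D/F) -> Tor_p(D/E). This lemma and the next three are the parts
    of the long exact sequence for F, E, D, by diagram chases on chains. *)
Lemma tor_vanish_le D E F p q : (forall m, E m -> D m) -> (forall m, F m -> E m) ->
  tor_vanish D E p q -> tor_vanish E F p q -> tor_vanish D F p q.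
Proof.
move=> ED FE DEv EFv z Dz qz Fz.
have [w [Dw qw Ezw]] := DEv z Dz qz (bd_suppW FE Fz).
have qzw := hdegB qz (hdeg_mul qw).
have [w' [Ew' qw' Fw']] := EFv _ Ezw qzw (bd_suppB Fz (bd_supp_diff F w)).
exists (w + w'); split; last by rewrite mulmxDl opprD addrA.
- by apply: row_suppD => //; apply: row_suppW Ew' => _; exact: ED.
- exact: row_suppD.
Qed.

(** Tor_0(D/F) maps onto Tor_0(D/E). *)
Lemma tor_vanish_quo0 D E F q : (forall m, F m -> E m) ->
  tor_vanish D F 0 q -> tor_vanish D E 0 q.
Proof.
move=> FE DFv z Dz qz _; have [//|w [Dw qw Fzw]] := DFv z Dz qz.
by exists w; split=> //; apply: row_suppW Fzw => _; exact: FE.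
Qed.

(** Exactness of Tor_(p+1)(D/F) -> Tor_(p+1)(D/E) -> Tor_p(E/F). *)
Lemma tor_vanish_quo D E F p q : (forall m, E m -> D m) -> (forall m, F m -> E m) ->
  tor_vanish D F p.+1 q -> tor_vanish E F p q -> tor_vanish D E p.+1 q.
Proof.
move=> ED FE DFv EFv z Dz qz Ez.
have [w [Ew qw Fzw]] := EFv _ Ez (hdeg_mul qz) (bd_supp_diff F z).
have Dzw : supp_in D (z - w) by apply: row_suppB => //; apply: row_suppW Ew => _; exact: ED.
have Fbd : bd_supp F (z - w) by rewrite /= mulmxBl.
have [w' [Dw' qw' Fw']] := DFv _ Dzw (hdegB qz qw) Fbd.
exists w'; split=> //; rewrite -[z](subrK w) addrAC; apply: row_suppD => //.
by apply: row_suppW Fw' => _; exact: FE.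
Qed.

(** Exactness of Tor_(p+1)(D/E) -> Tor_p(E/F) -> Tor_p(D/F). *)
Lemma tor_vanish_sub D E F p q : (forall m, E m -> D m) -> (forall m, F m -> E m) ->
    up_closed E -> tor_vanish D F p q -> tor_vanish D E p.+1 q ->
  tor_vanish E F p q.
Proof.
move=> ED FE uE DFv DEv z Ez qz Fz.
have Dz : supp_in D z by apply: row_suppW Ez => _; exact: ED.
have [w [Dw qw Fzw]] := DFv z Dz qz Fz.
have Ewd : bd_supp E w.
  rewrite /= -[w *m _](subKr z); apply: row_suppB => //.
  by apply: row_suppW Fzw => _; exact: FE.
have [w' [Dw' qw' Ew']] := DEv w Dw qw Ewd.
exists (w - w' *m d p.+1); split; [exact: Ew'|exact: hdegB qw (hdeg_mul qw')|].
by rewrite mulmxBl diffK subr0.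
Qed.

(** * Tor of the residue field and filtration by degree *)

Definition var_ideal i : mon -> Prop := fun m => exists2 l : 'I_n, (l < i)%N & (0 < m l)%N.

Lemma var_ideal_up i : up_closed (var_ideal i).
Proof. by move=> u m [l li ul]; exists l => //; rewrite mnmDE; lia. Qed.

(* The Koszul computation of Tor(K, K), one variable at a time. *)
Lemma tor_vanish_vars i p q : (i <= n)%N -> q <> p%:Z ->
  tor_vanish (fun=> True) (var_ideal i) p q.
Proof.
elim: i p q => [|i IHi] p q.
  move=> _ qp z _ qz bz.
  (* [var_ideal 0] is empty, so the complex is P itself, whose only homology is K in homological and
     internal degree 0. *)
  suff [w zw] : exists w, z = w *m d p.
    have [||w' [_ qw' zw']] := @hdeg_lift (fun=> True) (fun=> False) p q z w qz => //.
      by rewrite zw subrr; exact: row_supp0.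
    by exists w'; split=> //; apply: row_suppW zw'.
  case: p qp z qz bz => [|p] qp z qz /= bz.
    apply/aug_exact; apply: big1 => j _.
    have [->|/aug_homog shj] := eqVneq (aug P j 0) 0; first by rewrite mulr0.
    have [|/memN_msupp_eq0->] := boolP (0%MM \in msupp (z 0 j)); last by rewrite mul0r.
    by move/qz; rewrite shj mdeg0 => /esym.
  apply/diff_exact/row_supp_eq0.
  by apply: row_suppW bz => j m [].
move=> lin qp z _ qz bz.
have {}IHi := IHi _ _ (ltnW lin).
pose x : mon := U_(Ordinal lin)%MM.
(* The new variable is a nonzerodivisor modulo the previous ones. *)
have x_free m : var_ideal i (x + m)%MM -> var_ideal i m.
  move=> [l li]; rewrite mnmDE mnm1E => h; exists l => //; move: h.
  by case: eqP => [E|//]; move: li; rewrite -E /= ltnn.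
case: p qp z qz bz => [|p] qp z qz bz.
  apply: (@tor_vanish_quo0 _ _ (var_ideal i)) (IHi 0 q qp) _ _ _ _ => // m [l li].
  by exists l => //; lia.
(* The boundary of [z] is y + x z' with y over the smaller ideal; z' represents the image of [z]
   under the connecting map. If [w] bounds z' modulo the smaller ideal, then z - x w is a cycle
   modulo that ideal. *)
have [y [y2 [zd sy sy2]]] := row_supp_split (fun _ => var_ideal i) (z *m d p).
have Ey : supp_in (var_ideal i) y by apply: row_suppW (sy _ bz) => j m [].
have [z' y2E] : exists z', y2 = 'X_[x] *: z'.
  apply: row_suppXM_ex; apply: row_suppW (sy2 _ bz) => j m [[l li ml] nm].
  apply/mnm_lepP => k; rewrite mnm1E; case: eqP => // <-.
  have [El|ne] := eqVneq l (Ordinal lin); first by rewrite -El.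
  case: nm; exists l => //; move: ne; rewrite -val_eqE /=; lia.
have qz' : hdeg (q - 1) z'.
  have : hdeg q y2 by apply: row_suppW (sy2 _ (hdeg_mul qz)) => j m [].
  by rewrite y2E => /hdegXM; rewrite mdeg1.
have bz' : bd_supp (var_ideal i) z'.
  apply: (bd_supp_divX x_free); rewrite -y2E.
  rewrite -[y2](addKr y) -zd addrC; apply: bd_suppB; first exact: bd_supp_diff.
  exact: supp_bd (@var_ideal_up i) Ey.
have [||w [_ qw Ew]] := IHi p (q - 1) _ z' _ qz' bz' => //; first by lia.
have qxw : hdeg q ('X_[x] *: w) by apply/hdegXM; rewrite mdeg1.
have [||w' [_ qw' Ew']] := IHi p.+1 q qp (z - 'X_[x] *: w) _ (hdegB qz qxw).
- by [].
- rewrite /= mulmxBl zd y2E -scalemxAl -addrA -scalerBr.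
  apply: row_suppD => //; apply/row_suppXM.
  by apply: row_suppW Ew => j m; rewrite addmC; exact: var_ideal_up.
exists w'; split=> //; rewrite -[z](subrK ('X_[x] *: w)) addrAC.
apply: row_suppD; first by apply: row_suppW Ew' => j m [l li]; exists l => //; lia.
by apply/row_suppXM => j m _; exists (Ordinal lin) => //=; rewrite mnmDE mnm1E eqxx.
Qed.

Lemma hdeg_bound q p : exists N, forall (v : 'rV[S]_(rank P p)) e, hdeg q v ->
  (N <= e)%N -> supp_in (fun m => mdeg m < e)%N v.
Proof.
exists (\max_j (absz (q - shift (j : 'I_(rank P p)))).+1)%N => v e qv Ne j m /qv mj.
apply: leq_trans Ne; apply: (leq_trans (_ : _ <= `|q - shift j|.+1)%N); first lia.
exact: (leq_bigmax j).
Qed.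

Lemma supp_in_seq p (v : 'rV[S]_(rank P p)) :
  exists s : seq mon, supp_in (fun m => m \in s) v.
Proof.
exists (flatten [seq msupp (v 0 j) | j <- enum 'I_(rank P p)]) => j m mv.
by apply/flattenP; exists (msupp (v 0 j)) => //; apply: map_f; rewrite mem_enum.
Qed.

(** Terms of [z2] do not divide [u], so the coefficient at [u] of the boundary is the constant term
    of the boundary of [c]. It vanishes because [u] is outside [E]: thus [c] is a cycle modulo the
    maximal ideal. *)
Lemma bd_supp_isolated E u p (c z2 : 'rV[S]_(rank P p)) :
    up_closed E -> ~ E u -> supp_in (fun m => ~ (m <= u)%MM) z2 ->
  bd_supp E ('X_[u] *: c + z2) -> bd_supp (var_ideal n) c.
Proof.
case: p c z2 => [//|p] c z2 uE nEu sz2 /= Ez j m mc.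
have [m0|] := eqVneq m 0%MM; last first.
  by rewrite -mdeg_eq0 mdegE sum_nat_eq0 => /forallPn[l /=]; exists l => //; lia.
case: nEu; apply: (Ez j); rewrite mulmxDl mxE mcoeff_msupp mcoeffD -scalemxAl.
rewrite [X in _ + X](_ : _ = 0) ?addr0.
  rewrite mxE; have := mcoeffXM u 0%MM ((c *m d p) 0 j).
  by rewrite addm0 => ->; rewrite -m0 -mcoeff_msupp.
apply/memN_msupp_eq0; apply/negP => /(supp_in_mul (@not_le_up _ u) sz2).
by case; exact: lepm_refl.
Qed.

(* D/E is filtered by degree with quotients that are direct sums of copies
   of K, and Tor_p(K, K) lives in degree p. *)
Lemma tor_vanish_degree D E p q : up_closed D -> up_closed E ->
  (forall m, E m -> D m) ->
  (forall m, D m -> ~ E m -> (mdeg m + p)%:Z <> q) -> tor_vanish D E p q.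
Proof.
move=> uD uE ED nq z Dz qz bz.
pose W (F : mon -> Prop) := exists w : 'rV[S]_(rank P p.+1),
  [/\ supp_in D w, hdeg q w & supp_in F (z - w *m d p)].
(* [s] lists the monomials of degree [e] still allowed in the remainder. Each one in [D] but not in
   [E] is removed at the cost of terms of larger degree. *)
have layer e (s : seq mon) (w : 'rV[S]_(rank P p.+1)) : supp_in D w -> hdeg q w ->
    supp_in (fun m => E m \/ (e < mdeg m)%N \/ m \in s /\ mdeg m = e) (z - w *m d p) ->
    W (fun m => E m \/ (e < mdeg m)%N).
  elim: s w => [|u s IHs] w Dw qw szw.
    exists w; split=> //; apply: row_suppW szw => j m; rewrite in_nil.
    by case=> [|[|[]]] //; [left|right].
  set z' := z - w *m d p in szw *.
  have Dz' : supp_in D z' by apply: row_suppB => //; exact: supp_in_mul.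
  have qz' : hdeg q z' by apply: hdegB => //; exact: hdeg_mul.
  have bz' : bd_supp E z' by apply: bd_suppB => //; exact: bd_supp_diff.
  have [[Du nEu ue]|nu] := pselect [/\ D u, ~ E u & mdeg u = e]; last first.
    apply: (IHs w) => // j m mz; have Dm := Dz' _ _ mz; move/szw: mz.
    rewrite inE; case=> [|[|[/orP[/eqP um|] me]]]; [tauto|tauto| |tauto].
    subst m; left; apply: contrapT => nE; exact: nu.
  have [z1 [z2 [z'E s1 s2]]] := row_supp_split (fun _ m => m = u) z'.
  have [c z1E] : exists c, z1 = 'X_[u] *: c.
    by apply: row_suppXM_ex; apply: row_suppW (s1 _ szw) => j m [_ ->]; exact: lepm_refl.
  have qc : hdeg (q - e%:Z) c.
    by rewrite -ue; apply/hdegXM; rewrite -z1E; apply: row_suppW (s1 _ qz') => j m [].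
  have bc : bd_supp (var_ideal n) c.
    apply: (bd_supp_isolated uE nEu (z2 := z2)); last by rewrite -z1E -z'E.
    apply: row_suppW (s2 _ szw) => j m [mE mu] le_mu.
    have ne : (mdeg m < e)%N.
      by rewrite ltnNge -ue; apply/negP => /(mnm_le_mdeg_eq le_mu).
    case: mE => [Em|]; last by lia.
    by apply: nEu; rewrite -(submK le_mu) addmC; exact: uE.
  (* The coefficient [c] at x^u is a cycle for Tor_p(K,K) in degree q - e, which differs from p by
     [nq]. *)
  have [||y [_ qy Ey]] := tor_vanish_vars (leqnn n) _ _ qc bc; [|by []|].
    by move: (nq u Du nEu); rewrite ue; lia.
  apply: (IHs (w + 'X_[u] *: y)).
  - apply: row_suppD => //; apply/row_suppXM => j m _; exact: uD.
  - by apply: row_suppD => //; apply/hdegXM; rewrite ue.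
  rewrite mulmxDl opprD addrA -/z' z'E -scalemxAl addrAC z1E -scalerBr.
  apply: row_suppD.
    apply/row_suppXM; apply: row_suppW Ey => j m [l _ ml]; right; left.
    rewrite mdegD ue; suff : (0 < mdeg m)%N by lia.
    by rewrite mdegE (bigD1 l) //=; lia.
  apply: row_suppW (s2 _ szw) => j m []; rewrite inE.
  by case=> [|[|[/orP[/eqP|] me]]] mu nmu; [left|right; left|case: nmu|right; right].
have all_layers e : W (fun m => E m \/ (e <= mdeg m)%N).
  elim: e => [|e [w [Dw qw zw]]].
    exists 0; split; try exact: row_supp0.
    by rewrite mul0mx subr0; move=> j m _; right.
  have [s zs] := supp_in_seq (z - w *m d p).
  apply: (layer e s w) => // j m mz; have [|le] := zw _ _ mz; first by left.
  by right; have := zs _ _ mz; have [|/eqP] := ltnP e (mdeg m); [left|right; split=> //; lia].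
(* The remainder is homogeneous of degree [q], and P_p has finite rank, so no term of degree at
   least [N] is left. *)
have [N HN] := hdeg_bound q p.
have [w [Dw qw zw]] := all_layers N.
exists w; split=> // j m mz; have [//|] := zw _ _ mz.
by have := HN _ _ (hdegB qz (hdeg_mul qw)) (leqnn N) _ _ mz; lia.
Qed.
End TorVanishing.

(** * Multiplication by a variable, generators and Nakayama *)

Section Homotopy.
Variables (K : fieldType) (n : nat) (P : free_resolution K n).
Local Notation S := {mpoly K[n]}.
Local Notation mon := 'X_{1..n}.
Local Notation d := (diff P).
Local Notation tor_vanish := (tor_vanish P).
Implicit Types (f g : S) (u m : mon) (D E F : mon -> Prop) (p : nat) (q : int).

Lemma aug_row m j : (m != 0%MM) || (aug P j 0 == 0) ->
  exists y : 'rV[S]_(rank P 1), 'X_[m] *: delta_mx 0 j = y *m d 0.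
Proof.
move=> mj; apply/aug_exact; apply: big1 => k _; rewrite !mxE eqxx /=.
have [->|_] := eqVneq k j; last by rewrite mulr0 mcoeff0 mul0r.
rewrite mulr1 mcoeffX; case/orP: mj => [/negPf->|/eqP->]; first by rewrite mul0r.
by rewrite mulr0.
Qed.

Lemma in_kernel_diff p (w : 'rV[S]_(rank P p.+1)) : in_kernel (w *m d p).
Proof. by case: p w => [//|p] w; exact: diffK. Qed.

(** Multiplication by x_i is 0 on K, hence null-homotopic on P; only the half of the homotopy seen
    by cycles is recorded. Being a matrix, [s] keeps rows over an ideal, and so x_i kills Tor. *)
Lemma var_homotopy (i : 'I_n) p :
  exists s : 'M[S]_(rank P p, rank P p.+1),
    forall v, in_kernel v -> v *m s *m d p = 'X_[U_(i)] *: v.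
Proof.
elim: p => [|p [s sP]].
  have ex j : exists y : 'rV[S]_(rank P 1), 'X_[U_(i)] *: delta_mx 0 j = y *m d 0.
    by apply: aug_row; rewrite -mdeg_eq0 mdeg1.
  have [f fP] := choice ex.
  exists (\matrix_j f j) => v _; rewrite -mulmxA (_ : _ *m d 0 = 'X_[U_(i)]%:M).
    by rewrite mul_mx_scalar.
  by apply/row_matrixP => j; rewrite row_mul rowK -fP rowE mul_mx_scalar.
(* By induction x_i e_j - (d e_j) s is a cycle, and a preimage of it is the row [j] of the next
   homotopy. *)
have ex j : exists y : 'rV[S]_(rank P p.+2),
    'X_[U_(i)] *: delta_mx 0 j - row j (d p) *m s = y *m d p.+1.
  apply/diff_exact; rewrite mulmxBl sP; last by rewrite rowE; exact: in_kernel_diff.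
  by rewrite -scalemxAl -rowE subrr.
have [f fP] := choice ex.
exists (\matrix_j f j) => v /= v0.
rewrite -mulmxA (_ : _ *m d p.+1 = 'X_[U_(i)]%:M - d p *m s).
  by rewrite mulmxBr mul_mx_scalar mulmxA v0 mul0mx subr0.
apply/row_matrixP => j; rewrite row_mul rowK -fP raddfB /=.
by rewrite row_mul [row j _%:M]rowE mul_mx_scalar.
Qed.

Lemma bd_supp0 p (v : 'rV[S]_(rank P p)) : bd_supp (fun=> False) v <-> in_kernel v.
Proof.
case: p v => [//|p] v; split=> /= [/row_supp_eq0 //|->]; exact: row_supp0.
Qed.

Lemma supp_in_sub0 p (v w : 'rV[S]_(rank P p)) :
  supp_in (fun=> False) (v - w) <-> v = w.
Proof.
split=> [/row_supp_eq0/eqP|->]; first by rewrite subr_eq0 => /eqP.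
by rewrite subrr; exact: row_supp0.
Qed.

(** Tor_0(D) is D tensored with K, which lives in the degrees of the generators of D. *)
Lemma tor_vanish_gen D r q : up_closed D ->
  (forall m, D m -> exists u, [/\ D u, (u <= m)%MM & (mdeg u <= r)%N]) ->
  r%:Z < q -> tor_vanish D (fun=> False) 0 q.
Proof.
move=> uD genD rq z Dz qz _.
suff [w Dw zw] : exists2 w, supp_in D w & z = w *m d 0.
  by apply: (hdeg_lift qz Dw); apply/supp_in_sub0.
pose T (v : 'rV[S]_(rank P 0)) := exists2 w, supp_in D w & v = w *m d 0.
have T0 : T 0 by exists 0; [exact: row_supp0|rewrite mul0mx].
have TD v w : T v -> T w -> T (v + w).
  move=> [v' Dv ->] [w' Dw ->]; exists (v' + w'); last by rewrite mulmxDl.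
  exact: row_suppD.
rewrite -/(T z) [z]row_sum_delta; apply: (big_ind T) => // j _.
rewrite [z 0 j]mpolyE scaler_suml big_seq; apply: (big_ind T) => // m mz.
have [u [Du um ur]] := genD _ (Dz _ _ mz).
(* Either a variable is left in [m - u] or [e_j] maps to 0 in K; otherwise [q] would be the degree
   of [u], which is at most [r]. *)
have [|y yP] := @aug_row (m - u)%MM j.
  have [mu0|//] := eqVneq (m - u)%MM 0%MM.
  apply: contraT => /= /aug_homog shj; have := qz _ _ mz.
  by rewrite shj -(submK um) mu0 add0m; lia.
exists ('X_[u] *: (((z 0 j)@_m)%:MP *: y)).
  by apply/row_suppXM => k m' _; exact: uD.
rewrite -!scalemxAl -yP !scalerA -mul_mpolyC; congr (_ *: _).
by rewrite [in RHS]mulrAC -mpolyXD addmC submK // mulrC.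
Qed.

(** If [u] has least degree in [E] outside [F], and [e_j] is not mapped to 0 in K, then x^u e_j has
    a nonzero class in Tor_0(E/F). *)
Lemma tor_vanish_nakayama E F : up_closed E -> up_closed F ->
  (forall u, E u -> ~ F u -> tor_vanish E F 0 (mdeg u)%:Z) ->
  forall u, E u -> F u.
Proof.
move=> uE uF EFv u; have [N] := ubnP (mdeg u); elim: N u => // N IHN u uN Eu.
apply: contrapT => nFu.
have [j augj] : exists j, aug P j 0 != 0.
  apply: contrapT => naug; case/negP: (aug_surj P); apply/eqP/matrixP => j k.
  by rewrite (ord1 k) mxE; apply/eqP/negPn/negP => h; apply: naug; exists j.
pose z : 'rV[S]_(rank P 0) := 'X_[u] *: delta_mx 0 j.
have Ez : supp_in E z by apply/row_suppXM => k m _; exact: uE.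
have qz : hdeg (mdeg u)%:Z z.
  apply/hdegXM => k m; rewrite !mxE /=; have [->|_] := eqVneq k j; last first.
    by rewrite msupp0.
  by rewrite msupp1 inE => /eqP->; rewrite (aug_homog augj) mdeg0; lia.
have [w [Ew _ Fzw]] := EFv u Eu nFu z Ez qz I.
have [w1 [w2 [wE s1 s2]]] := row_supp_split (fun _ m => m = u) w.
have [c w1E] : exists c, w1 = 'X_[u] *: c.
  by apply: row_suppXM_ex; apply: row_suppW (s1 _ Ew) => k m [_ ->]; exact: lepm_refl.
(* A proper divisor of [u] in [E] lies in [F] by minimality, and would put [u] in [F]. *)
have sw2 : supp_in (fun m => ~ (m <= u)%MM) w2.
  apply: row_suppW (s2 _ Ew) => k m [Em mu] le_mu; apply: nFu.
  rewrite -(submK le_mu) addmC; apply: uF; apply: IHN => //.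
  rewrite -ltnS; apply: leq_trans uN; rewrite ltnS ltnNge; apply/negP.
  by move/(mnm_le_mdeg_eq le_mu).
(* Comparing coefficients at [u] shows that the boundary [c *m d 0] has constant part [e_j],
   although boundaries map to 0 in K. *)
have coef k : ((c *m d 0) 0 k)@_0%MM = (k == j)%:R.
  have : ((z - w *m d 0) 0 k)@_u = 0 by apply/memN_msupp_eq0/negP => /Fzw.
  have w20 : ((w2 *m d 0) 0 k)@_u = 0.
    apply/memN_msupp_eq0/negP => /(supp_in_mul (@not_le_up _ u) sw2).
    by case; exact: lepm_refl.
  rewrite wE w1E mulmxDl -scalemxAl !mxE mcoeffB mcoeffD.
  move: w20; rewrite mxE => ->; rewrite addr0.
  have := mcoeffXM u 0%MM; rewrite addm0 => XE.
  rewrite !XE eqxx /= => /eqP; rewrite subr_eq0 => /eqP <-.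
  by case: (k == j); rewrite ?mcoeff0 // mcoeff1 eqxx.
have /aug_exact : exists y, c *m d 0 = y *m d 0 by exists c.
rewrite (bigD1 j) //= coef eqxx mul1r big1 ?addr0 => [/eqP|k kj]; first by rewrite (negPf augj).
by rewrite coef (negPf kj) mul0r.
Qed.

End Homotopy.

(** * Changing one exponent *)

Section ExponentChange.
Variables (K : fieldType) (n : nat) (P : free_resolution K n).
Local Notation S := {mpoly K[n]}.
Local Notation mon := 'X_{1..n}.
Local Notation d := (diff P).
Local Notation tor_vanish := (tor_vanish P).
(** By [A_free] and [B_free], x_i is a nonzerodivisor modulo each [A k] and [B r]. By [A_deg] and
    [A_mono], raising the index of [A] beyond [k] adds no elements of degree at most [k]. *)
Variables (i : 'I_n) (c : nat) (A B : nat -> mon -> Prop).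
Hypotheses (c_gt0 : (0 < c)%N)
  (A_up : forall k, up_closed (A k)) (B_up : forall r, up_closed (B r))
  (A_free : forall k m, A k (U_(i) + m)%MM -> A k m)
  (B_free : forall r m, B r (U_(i) + m)%MM -> B r m)
  (A_mono : forall k l m, (k <= l)%N -> A k m -> A l m)
  (A_deg : forall k l m, A l m -> (mdeg m <= k)%N -> A k m)
  (B_gen : forall r m, B r m -> exists u, [/\ B r u, (u <= m)%MM & (mdeg u <= r)%N]).

(* A k + x_i ^ e B (k - e) *)
Definition glue e k m := A k m \/ [/\ (e <= k)%N, (e <= m i)%N & B (k - e) m].

Let xpow e : mon := (U_(i) *+ e)%MM.

Lemma xpow_le e m : (xpow e <= m)%MM = (e <= m i)%N.
Proof.
apply/mnm_lepP/idP => [/(_ i)|em l]; rewrite mulmnE mnm1E; first by rewrite eqxx mul1n.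
by case: eqP => [<-|]; rewrite ?mul1n.
Qed.

Lemma mdeg_xpow e : mdeg (xpow e) = e.
Proof. by rewrite mdegMn mdeg1 mul1n. Qed.

Lemma free_xpow (D : mon -> Prop) e m :
  (forall m, D (U_(i) + m)%MM -> D m) -> D (xpow e + m)%MM -> D m.
Proof.
move=> Df; elim: e m => [|e IH] m; first by rewrite /xpow mulm0n add0m.
by rewrite /xpow mulmS -addmA => /Df/IH.
Qed.

Hypothesis H : forall k p q, (p + k)%:Z < q -> tor_vanish (glue c k) (fun=> False) p q.

(* A cycle over A bounds over glue c k; splitting off the part of the bounding
   chain divisible by x_i leaves x_i times a cycle over A. *)
Lemma tor_vanish_A k p q : (p + k)%:Z < q -> tor_vanish (A k) (fun=> False) p q.
Proof.
move=> kq z Az qz z0.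
have Gz : supp_in (glue c k) z by apply: row_suppW Az => j m; left.
have [w [Gw _ /supp_in_sub0 zw]] := H kq Gz qz z0.
have [w1 [w2 [wE s1 s2]]] := row_supp_split (fun _ m => (U_(i) <= m)%MM) w.
have Aw2 : supp_in (A k) w2.
  apply: row_suppW (s2 _ Gw) => j m [[//|[_ cm _]] nm]; case: nm.
  by rewrite (xpow_le 1); lia.
have [w1' w1E] : exists w1', w1 = 'X_[U_(i)] *: w1'.
  by apply: row_suppXM_ex; apply: row_suppW (s1 _ Gw) => j m [].
have Aw1 : supp_in (A k) (w1' *m d p).
  apply: (supp_in_divX (@A_free k)); rewrite scalemxAl -w1E -[w1](addrK w2) -wE mulmxBl -zw.
  by apply: row_suppB => //; exact: supp_in_mul.
(* The cycle [w1' *m d p] is over [A k]; its image under [s] is therefore over [A k] as well and has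
   boundary x_i times the cycle, which is [w1 *m d p]. *)
have [s sP] := var_homotopy P i p.
apply: (@hdeg_lift _ _ _ _ _ _ _ _ (w1' *m d p *m s + w2)) => //.
  by apply: row_suppD => //; exact: supp_in_mul.
apply/supp_in_sub0; rewrite mulmxDl sP; last exact: in_kernel_diff.
by rewrite scalemxAl -w1E -mulmxDl -wE.
Qed.

(** For k = r + c, multiplication by x_i^c identifies B_r / (B_r :&: A_k), shifted by c, with J /
    A_k, where J is [glue c k]. *)
Lemma tor_vanish_B r p q : (p + r)%:Z < q ->
  tor_vanish (B r) (fun m => B r m /\ A (r + c) m) p q.
Proof.
move=> rq z Bz qz bz; set k := (r + c)%N.
have kr : (k - c = r)%N by rewrite addnK.
(* From Tor_p(J) -> Tor_p(J/A_k) -> Tor_(p-1)(A_k): in degree q + c > p + k both outer terms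
   vanish. *)
have JA : tor_vanish (glue c k) (A k) p (q + c%:Z).
  have V p' : (p' <= p)%N -> tor_vanish (glue c k) (fun=> False) p' (q + c%:Z).
    by move=> pp; apply: H; lia.
  case: (p) rq V => [|p'] rq' V; first by apply: tor_vanish_quo0 (V _ _).
  apply: (@tor_vanish_quo _ _ _ _ _ (fun=> False)) => //; first by move=> m; left.
    exact: V.
  by apply: tor_vanish_A; lia.
have Gz : supp_in (glue c k) ('X_[xpow c] *: z).
  apply/row_suppXM; apply: row_suppW Bz => j m Bm; right; split; first exact: leq_addl.
    by rewrite -xpow_le mnm_le_up.
  by rewrite kr addmC; exact: B_up.
have qz' : hdeg (q + c%:Z) ('X_[xpow c] *: z) by apply/hdegXM; rewrite mdeg_xpow addrK.
have bz' : bd_supp (A k) ('X_[xpow c] *: z).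
  apply/bd_suppXM; apply: bd_suppW bz => m [_ Am].
  by rewrite addmC; exact: A_up.
have [w [Gw _ Aw]] := JA _ Gz qz' bz'.
(* The part of the bounding chain over [A k] is absorbed in the remainder; the other part is x_i^c
   times a chain over [B r]. *)
have [w1 [w2 [wE s1 s2]]] := row_supp_split (fun _ m => A k m) w.
have Aw1 : supp_in (A k) w1 by apply: row_suppW (s1 _ Gw) => j m [].
have s2' : supp_in (fun m => (c <= m i)%N /\ B r m) w2.
  by apply: row_suppW (s2 _ Gw) => j m [[//|[_ cm]]]; rewrite kr.
have [w' w'E] : exists w', w2 = 'X_[xpow c] *: w'.
  by apply: row_suppXM_ex; apply: row_suppW s2' => j m [cm _]; rewrite xpow_le.
have Bw' : supp_in (B r) w'.
  apply: (@supp_in_divX _ _ _ _ (xpow c)) => [m|]; first exact: free_xpow (@B_free r).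
  by rewrite -w'E; apply: row_suppW s2' => j m [].
apply: (hdeg_lift qz Bw').
have Bzw : supp_in (B r) (z - w' *m d p) by apply: row_suppB => //; exact: supp_in_mul.
suff Azw : supp_in (A k) (z - w' *m d p) by move=> j m mz; split; [exact: Bzw mz|exact: Azw mz].
apply: (@supp_in_divX _ _ _ _ (xpow c)) => [m|]; first exact: free_xpow (@A_free k).
rewrite scalerBr scalemxAl -w'E -[w2](addKr w1) -wE [- w1 + w]addrC.
rewrite mulmxBl opprB addrCA; apply: row_suppD; last exact: Aw.
exact: supp_in_mul.
Qed.

(* B r / (B r :&: A (r + c)) has no relations in degrees above r + 1. *)
Lemma B_cap_A r m : B r m -> A (r + c) m -> A r.+1 m.
Proof.
move=> Bm Am.
pose E m := B r m /\ A (r + c) m; pose F m := B r m /\ A r.+1 m.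
have uE : up_closed E by move=> u v [Bu Au]; split; [exact: B_up|exact: A_up].
have uF : up_closed F by move=> u v [Bu Au]; split; [exact: B_up|exact: A_up].
have FE u : F u -> E u by move=> [Bu Au]; split=> //; apply: A_mono Au; lia.
suff EF : forall u, E u -> F u by case: (EF m).
apply: (tor_vanish_nakayama uE uF) => u [Bu Au] nFu.
have ru : (r.+1 < mdeg u)%N.
  by rewrite ltnNge; apply/negP => ur; apply: nFu; split=> //; exact: A_deg Au ur.
(* Tor_0(E/F) sits between Tor_1(B_r/E) and Tor_0(B_r/F). In degree above r + 1 the former is 0 by
   [tor_vanish_B], the latter because B_r is generated in degrees at most r. *)
apply: (@tor_vanish_sub _ _ _ (B r)) => //; first by move=> v [].
  apply: (@tor_vanish_quo0 _ _ _ _ _ (fun=> False)) => //.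
  by apply: (@tor_vanish_gen _ _ _ _ r) => //; [exact: B_gen|lia].
by apply: tor_vanish_B; lia.
Qed.

(** For k = r + 1, the quotient of [glue 1 k] by [A k] is B_r / (B_r :&: A_(r+1)) shifted by 1, and
    by [B_cap_A] this is the module treated in [tor_vanish_B]. *)
Lemma tor_vanish_glue1 k p q : (p + k)%:Z < q ->
  tor_vanish (glue 1 k) (fun=> False) p q.
Proof.
move=> kq.
apply: (@tor_vanish_le _ _ _ _ (A k)) => //; first by move=> m; left.
  (* For k = 0 the condition 1 <= k in [glue] fails, and [glue 1 0] is [A 0]. *)
  case: k kq => [|r] kq z Gz qz bz.
    exists 0; split; try exact: row_supp0.
    by rewrite mul0mx subr0; apply: row_suppW Gz => j m [//|[]].
  have [z1 [z2 [zE s1 s2]]] := row_supp_split (fun _ m => A r.+1 m) z.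
  have Az1 : supp_in (A r.+1) z1 by apply: row_suppW (s1 _ Gz) => j m [].
  have s2' : supp_in (fun m => (0 < m i)%N /\ B r m) z2.
    by apply: row_suppW (s2 _ Gz) => j m [[//|[_ cm]]]; rewrite subn1.
  have [z' z'E] : exists z', z2 = 'X_[U_(i)] *: z'.
    by apply: row_suppXM_ex; apply: row_suppW s2' => j m [cm _]; rewrite (xpow_le 1).
  have Bz' : supp_in (B r) z'.
    by apply: (supp_in_divX (@B_free r)); rewrite -z'E; apply: row_suppW s2' => j m [].
  have qz2 : hdeg q z2 by apply: row_suppW (s2 _ qz) => j m [].
  have qz' : hdeg (q - 1) z' by move: qz2; rewrite z'E => /hdegXM; rewrite mdeg1.
  have bz' : bd_supp (fun m => B r m /\ A (r + c) m) z'.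
    have Ab : bd_supp (A r.+1) z'.
      apply: (bd_supp_divX (@A_free r.+1)); rewrite -z'E -[z2](addKr z1) -zE addrC.
      apply: bd_suppB => //.
      exact: supp_bd.
    have := supp_bd (@B_up r) Bz'.
    case: (p) z' Ab {z'E qz' Bz'} => [//|p'] z' Ab Bb j m mz; split; first exact: Bb mz.
    by apply: A_mono (Ab _ _ mz); lia.
  have [|w [Bw qw Ew]] := @tor_vanish_B r p (q - 1) _ z' Bz' qz' bz'; first by lia.
  exists ('X_[U_(i)] *: w); split.
  - apply/row_suppXM; apply: row_suppW Bw => j m Bm; right; split=> //.
      by rewrite mnmDE mnm1E eqxx.
    by rewrite subn1 addmC; exact: B_up.
  - by apply/hdegXM; rewrite mdeg1.
  rewrite zE z'E -scalemxAl -addrA -scalerBr; apply: row_suppD => //.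
  apply/row_suppXM; apply: row_suppW Ew => j m [Bm Am]; rewrite addmC.
  by apply: A_up; exact: B_cap_A.
exact: tor_vanish_A.
Qed.

End ExponentChange.

(** * Componentwise linear monomial ideals *)

Section ComponentwiseLinear.
Variables (K : fieldType) (n : nat).
Local Notation S := {mpoly K[n]}.
Local Notation mon := 'X_{1..n}.
Implicit Types (f g : S) (u m : mon) (D : mon -> Prop) (G M : mon -> Prop).

Lemma mnm_between u m k : (u <= m)%MM -> (mdeg u <= k <= mdeg m)%N ->
  exists v, [/\ (u <= v)%MM, (v <= m)%MM & mdeg v = k].
Proof.
move=> um /andP[uk km]; elim: k uk km => [|k IHk] uk km.
  by exists u; split=> //; [exact: lepm_refl|lia].
have [->|uk'] := eqVneq k.+1 (mdeg u); first by exists u; split=> //; exact: lepm_refl.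
have [||v [uv vm vk]] := IHk; [by lia|by lia|].
have [l vl] : exists l, (v l < m l)%N.
  apply: contrapT => nl; have mv : (m <= v)%MM.
    by apply/mnm_lepP => l; rewrite leqNgt; apply/negP => h; apply: nl; exists l.
  have mvE : m = v by apply: mnm_le_mdeg_eq mv _; lia.
  by move: km; rewrite mvE; lia.
exists (v + U_(l))%MM; split; last by rewrite mdegD mdeg1 vk addn1.
  exact: lepm_trans uv (mnm_le_up _ _).
apply/mnm_lepP => j; rewrite mnmDE mnm1E; have /mnm_lepP/(_ j) := vm.
by case: eqP => [<-|]; lia.
Qed.

Lemma ideal_gen_monomials (H : S -> Prop) f :
  (forall m, m \in msupp f -> exists2 u, H 'X_[u] & (u <= m)%MM) -> ideal_gen H f.
Proof.
move=> Hf.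
have ex m : exists u, m \in msupp f -> H 'X_[u] /\ (u <= m)%MM.
  by have [/Hf[u Hu um]|_] := boolP (m \in msupp f); [exists u|exists m].
have [t tP] := choice ex.
exists [seq (f@_m *: 'X_[m - t m], 'X_[t m]) | m <- msupp f].
  by move=> _ /mapP[m /tP[Hm _] ->].
rewrite big_map [LHS]mpolyE; apply: eq_big_seq => m /tP[_ tm] /=.
by rewrite -scalerAl -mpolyXD submK.
Qed.

Lemma monomial_ideal_genP G f : monomial_ideal_gen G f <->
  forall m, m \in msupp f -> exists2 u, G u & (u <= m)%MM.
Proof.
split=> [[s sG ->] m|Gf].
  move=> /msupp_sum_le/flattenP[_ /mapP[t + ->]]; rewrite filter_predT => /sG[u Gu ->].
  by rewrite mulrC => /msuppXM[k _ ->]; exists u => //; exact: mnm_le_up.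
by apply: ideal_gen_monomials => m /Gf[u Gu um]; exists u => //; exists u.
Qed.

Lemma monomial_ideal_genX G m :
  monomial_ideal_gen G ('X_[m] : S) <-> exists2 u, G u & (u <= m)%MM.
Proof.
split=> [/monomial_ideal_genP/(_ m)|Gm]; first by apply; rewrite msuppX mem_head.
by apply/monomial_ideal_genP => k /mem_msuppXP <-.
Qed.

Definition ideal_le G k : mon -> Prop :=
  fun m => exists u, [/\ G u, (mdeg u <= k)%N & (u <= m)%MM].

Lemma ideal_le_up G k : up_closed (ideal_le G k).
Proof.
move=> v m [u [Gu uk uv]]; exists u; split=> //.
exact: lepm_trans uv (mnm_le_up _ _).
Qed.

(** Between a generator of degree at most [k] and a multiple of degree at least [k] lies a monomial
    of degree exactly [k]. Hence the component is the truncation of [ideal_le G k] to degrees at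
    least [k]. *)
Lemma component_monomial G k f : component (monomial_ideal_gen G) k f <->
  forall m, m \in msupp f -> ideal_le G k m /\ (k <= mdeg m)%N.
Proof.
split=> [[s sG ->] m|Gf].
  move=> /msupp_sum_le/flattenP[_ /mapP[t + ->]]; rewrite filter_predT.
  move=> /sG[/monomial_ideal_genP tG /dhomogP tk].
  case/msuppM_le/allpairsP => -[m1 m2] /= [_ m2t ->].
  have [u Gu um] := tG _ m2t; have mk : mdeg m2 = k := tk _ m2t.
  rewrite mdegD mk leq_addl; split=> //; exists u; rewrite -mk; split=> //.
    by rewrite -(submK um) mdegD leq_addl.
  by rewrite addmC; exact: lepm_trans um (mnm_le_up _ _).
apply: ideal_gen_monomials => m /Gf[[u [Gu uk um]] km].
have [|v [uv vm vk]] := mnm_between um (k := k); first by rewrite uk.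
exists v => //; split; last by apply/dhomogP => w /mem_msuppXP <-.
by apply/monomial_ideal_genX; exists u.
Qed.

Lemma graded_betti0P (L : S -> Prop) D p q :
  (forall f, L f <-> forall m, m \in msupp f -> D m) ->
  graded_betti L p q 0 <->
  forall P : free_resolution K n, tor_vanish P D (fun=> False) p q.
Proof.
move=> LD.
have tensorP (P : free_resolution K n) p' (v : 'rV_(rank P p')) :
    tensor_row L q v <-> supp_in D v /\ hdeg q v.
  by split=> -[Lv qv]; split=> // j; [have /LD := Lv j; apply|apply/LD => m; exact: Lv].
split=> b P.
  move=> z Dz qz /bd_supp0 z0; have [c _ /(_ z)] := b P.
  case=> [|t [[w /tensorP[Dw qw] zw] _]]; first by split=> //; apply/tensorP.
  by exists w; split=> //; apply/supp_in_sub0; rewrite -zw big_ord0 subr0.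
exists (fun=> 0) => [[]//|z [/tensorP[Dz qz] z0]].
have [|w [Dw qw /supp_in_sub0 zw]] := b P z Dz qz; first exact/bd_supp0.
exists 0; split=> [|t _]; last by apply/rowP => -[].
by exists w; [exact/tensorP|rewrite big_ord0 subr0].
Qed.

(** The quotient of [D] by its truncation lives in degrees below [k], so its Tor_p vanishes in
    degrees from p + k on; the truncation itself has no Tor_p below p + k. *)
Lemma tor_vanish_truncate (P : free_resolution K n) D k : up_closed D ->
  (forall p q, (p + k)%:Z < q -> tor_vanish P D (fun=> False) p q) <->
  (forall p q, q <> (p + k)%:Z ->
     tor_vanish P (fun m => D m /\ (k <= mdeg m)%N) (fun=> False) p q).
Proof.
move=> uD; pose T m := D m /\ (k <= mdeg m)%N.
have uT : up_closed T.
  by move=> u m [Du ku]; split; [exact: uD|rewrite mdegD; lia].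
have quo p q : (p + k)%:Z <= q -> tor_vanish P D T p q.
  move=> kq; apply: tor_vanish_degree => // [m []//|m Dm nT mq].
  by apply: nT; split=> //; lia.
split=> [Dv|Tv] p q kq; last first.
  apply: (@tor_vanish_le _ _ _ _ T) => //; [by move=> m []|apply: quo; lia|].
  by apply: Tv; lia.
have [qk|qk] : q < (p + k)%:Z \/ (p + k)%:Z < q by lia.
  by apply: tor_vanish_degree => // m [_ km] _ mq; lia.
apply: (@tor_vanish_sub _ _ _ D) => //; first by move=> m [].
  by apply: Dv; lia.
by apply: quo; lia.
Qed.

Lemma componentwise_linear_monomialP G :
  componentwise_linear (monomial_ideal_gen G : S -> Prop) <->
  forall (P : free_resolution K n) k p q, (p + k)%:Z < q ->
    tor_vanish P (ideal_le G k) (fun=> False) p q.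
Proof.
split=> [cl P k|reg k]; last first.
  exists k; first by exists (fun f => monomial_ideal_gen G f /\ f \is k.-homog) => // f [].
  move=> p q pq; apply/(graded_betti0P _ _ (component_monomial G k)) => P.
  exact: (tor_vanish_truncate P k (@ideal_le_up G k)).1 (reg P k) _ _ pq.
apply/(tor_vanish_truncate P k (@ideal_le_up G k)) => p q pq.
(* The zero component is treated apart, since it does not determine its generating degree. *)
have [[m0 [[u [Gu uk um]] km]]|empty] :=
    pselect (exists m, ideal_le G k m /\ (k <= mdeg m)%N); last first.
  move=> z Dz _ _; exists 0; split; try exact: row_supp0.
  by rewrite mul0mx subr0 => j m /Dz Dm; apply: empty; exists m.
have [e [H Hhom Hgen] b] := cl k.
(* A monomial of degree [k] in the component is a multiple of a monomial of degree [e] occurring in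
   a generator, so e <= k; all monomials of the component have degree at least [k]. *)
suff ek : e = k.
  by move: b; rewrite ek => /(_ p q pq)/(graded_betti0P _ _ (component_monomial G k))/(_ P).
have [|v [uv vm vk]] := mnm_between um (k := k); first by rewrite uk.
have Lv : component (monomial_ideal_gen G : S -> Prop) k 'X_[v].
  apply: (component_monomial G k _).2 => m /mem_msuppXP <-; rewrite vk; split=> //.
  by exists u.
have [s sH Xs] := (Hgen _).1 Lv.
have : v \in msupp ('X_[v] : S) by rewrite msuppX mem_head.
rewrite {1}Xs => /msupp_sum_le/flattenP[_ /mapP[t + ->]]; rewrite filter_predT => /sH Ht.
case/msuppM_le/allpairsP => -[m1 m2] /= [_ m2t vE].
have m2e : mdeg m2 = e by have /dhomogP := Hhom _ Ht; apply.
have km2 : (k <= mdeg m2)%N.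
  have /Hgen/component_monomial/(_ m2 m2t)[] // : ideal_gen H t.2.
  exists [:: (1, t.2)]; last by rewrite big_seq1 mul1r.
  by move=> x; rewrite inE => /eqP->.
by move: vk; rewrite vE mdegD; lia.
Qed.

(** * Minimal generators of a monomial ideal *)

Definition min_elts G u := G u /\ forall v, G v -> (v <= u)%MM -> v = u.

Lemma min_elts_below G u : G u -> exists2 v, min_elts G v & (v <= u)%MM.
Proof.
have [N] := ubnP (mdeg u); elim: N u => // N IHN u uN Gu.
have [Mu|nMu] := pselect (min_elts G u); first by exists u => //; exact: lepm_refl.
have [v [Gv vu ne]] : exists v, [/\ G v, (v <= u)%MM & v <> u].
  apply: contrapT => nv; apply: nMu; split=> // v Gv vu.
  by apply: contrapT => ne; apply: nv; exists v.
have [|//|w Mw wv] := IHN v; last by exists w => //; exact: lepm_trans wv vu.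
rewrite -ltnS; apply: leq_trans uN; rewrite ltnS ltnNge; apply/negP.
by move/(mnm_le_mdeg_eq vu).
Qed.

Lemma monomial_ideal_gen_sub G M f : (forall u, G u -> exists2 v, M v & (v <= u)%MM) ->
  monomial_ideal_gen G f -> monomial_ideal_gen M f.
Proof.
move=> GM /monomial_ideal_genP fG; apply/monomial_ideal_genP => m.
by move=> /fG[u /GM[v Mv vu] um]; exists v => //; exact: lepm_trans vu um.
Qed.

Lemma min_elts_generators (I : S -> Prop) G :
  monomial_generators I G -> monomial_generators I (min_elts G).
Proof.
move=> IG f; split=> [/IG|Mf]; first exact: monomial_ideal_gen_sub (@min_elts_below G).
apply/IG; apply: monomial_ideal_gen_sub Mf => u [Gu _].
by exists u => //; exact: lepm_refl.
Qed.

Lemma min_gensE (I : S -> Prop) G : monomial_generators I G -> min_gens I = min_elts G.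
Proof.
move=> IG; apply/funext => u; apply/propext; have IM := min_elts_generators IG.
have gen_le G1 G2 v : monomial_generators I G1 -> monomial_generators I G2 ->
    G1 v -> exists2 w, G2 w & (w <= v)%MM.
  move=> IG1 IG2 Gv; apply/monomial_ideal_genX/IG2/IG1/monomial_ideal_genX.
  by exists v => //; exact: lepm_refl.
have M_anti v w : min_elts G v -> min_elts G w -> (w <= v)%MM -> w = v.
  by move=> [_ Mv] [Gw _]; exact: Mv.
split=> [[G0 [IG0 G0min] G0u]|Mu]; last first.
  exists (min_elts G) => //; split=> // G' G'M IG' v Mv.
  have [w G'w wv] := gen_le _ _ _ IM IG' Mv.
  by rewrite -(M_anti _ _ Mv (G'M _ G'w) wv).
(* The members of [G0] minimal in [G] already generate, so minimality of [G0] forces all of [G0] to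
   be of this kind. *)
have IG0M : monomial_generators I (fun v => G0 v /\ min_elts G v).
  move=> f; split=> [/IM|G0f]; last first.
    by apply/IM; apply: monomial_ideal_gen_sub G0f => v [_ Mv]; exists v => //; exact: lepm_refl.
  apply: monomial_ideal_gen_sub => v Mv; have [w G0w wv] := gen_le _ _ _ IM IG0 Mv.
  have [v' Mv' v'w] := gen_le _ _ _ IG0 IM G0w.
  have vv' := M_anti _ _ Mv Mv' (lepm_trans v'w wv).
  have vw : v = w.
    apply/mnmP => l; apply/eqP; rewrite eqn_leq.
    by have /mnm_lepP/(_ l) := wv; have /mnm_lepP/(_ l) := v'w; rewrite vv' => -> ->.
  by exists v; [rewrite {1}vw|exact: lepm_refl].
have [_ Mu] := G0min _ (fun v => @proj1 _ _) IG0M u G0u; exact: Mu.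
Qed.

(** * Exponents of bracket ideals *)

Definition bracket_set G (c : 'I_n -> nat) : mon -> Prop :=
  fun v => exists2 u, G u & v = bracket_monomial c u.

Definition set_exp (c : 'I_n -> nat) i e : 'I_n -> nat := fun j => if j == i then e else c j.

Lemma bracket_set_exp c i e u : bracket_monomial (set_exp c i e) u =
  (bracket_monomial (set_exp c i 0) u + U_(i) *+ ((0 < u i)%N * e))%MM.
Proof.
apply/mnmP => j; rewrite mnmDE mulmnE mnm1E !mnmE /set_exp [j == i]eq_sym.
case: eqP => [->|_]; last by rewrite mul0n addn0.
by rewrite mul1n; case: ifP => _; rewrite ?mul0n ?mul1n.
Qed.

(** The generators are sorted by whether x_i divides [u]. Exponent 0 at [i] deletes x_i, and the
    deleted factor x_i^e accounts for the shift of the degree bound by [e]. *)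
Lemma ideal_le_glue G c i e k m :
  ideal_le (bracket_set G (set_exp c i e)) k m <->
  glue i (ideal_le (bracket_set (fun u => G u /\ u i = 0%N) (set_exp c i 0)))
    (ideal_le (bracket_set (fun u => G u /\ (0 < u i)%N) (set_exp c i 0))) e k m.
Proof.
have le_i0 u : (bracket_monomial (set_exp c i e) u <= m)%MM =
    (bracket_monomial (set_exp c i 0) u <= m)%MM && ((0 < u i)%N * e <= m i)%N.
  apply/mnm_lepP/andP => [h|[/mnm_lepP h hi] j].
    split; last by have := h i; rewrite !mnmE /set_exp eqxx; case: ifP; lia.
    by apply/mnm_lepP => j; have := h j; rewrite !mnmE /set_exp; case: (j == i); case: ifP; lia.
  have := h j; rewrite !mnmE /set_exp; case: eqP => [->|//] _.
  by case: ifP hi; lia.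
have deg u : mdeg (bracket_monomial (set_exp c i e) u) =
    (mdeg (bracket_monomial (set_exp c i 0) u) + (0 < u i)%N * e)%N.
  by rewrite bracket_set_exp mdegD mdegMn mdeg1 mul1n.
split.
  move=> [_ [[u Gu ->]]]; rewrite deg le_i0 => uk /andP[um ui].
  have [u0|u_gt0] := posnP (u i).
    left; exists (bracket_monomial (set_exp c i 0) u); split=> //; last by lia.
    by exists u.
  right; rewrite u_gt0 mul1n in uk ui; split=> //; first by lia.
  exists (bracket_monomial (set_exp c i 0) u); split=> //; last by lia.
  by exists u.
case=> [[_ [[u [Gu u0] ->] uk um]]|[ek em [_ [[u [Gu u0] ->] uk um]]]];
  exists (bracket_monomial (set_exp c i e) u); rewrite deg le_i0 u0 um ?mul1n ?em.
  by split=> //; [exists u|lia].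
by split=> //; [exists u|lia].
Qed.

Lemma tor_vanish_set_exp1 (P : free_resolution K n) G c i : (0 < c i)%N ->
  (forall k p q, (p + k)%:Z < q ->
     tor_vanish P (ideal_le (bracket_set G c) k) (fun=> False) p q) ->
  forall k p q, (p + k)%:Z < q ->
    tor_vanish P (ideal_le (bracket_set G (set_exp c i 1)) k) (fun=> False) p q.
Proof.
move=> ci H k p q kq.
have cE : set_exp c i (c i) = c by apply/funext => j; rewrite /set_exp; case: eqP => [->|].
(* The families [A] and [B] do not depend on [e], so the same ones serve for the exponents [c i] and
   1. *)
have glueE e l : ideal_le (bracket_set G (set_exp c i e)) l = glue i _ _ e l :=
  funext (fun m => propext (ideal_le_glue G c i e l m)).
have free G' l m : ideal_le (bracket_set G' (set_exp c i 0)) l (U_(i) + m)%MM ->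
    ideal_le (bracket_set G' (set_exp c i 0)) l m.
  move=> [_ [[u Gu ->] ul um]]; exists (bracket_monomial (set_exp c i 0) u).
  split=> //; first by exists u.
  apply/mnm_lepP => j; have /mnm_lepP/(_ j) := um.
  by rewrite mnmDE mnm1E !mnmE /set_exp [j == i]eq_sym; case: eqP => //; case: ifP.
rewrite glueE; apply: (@tor_vanish_glue1 _ _ _ _ (c i)) kq => //.
- by move=> l; exact: ideal_le_up.
- by move=> l; exact: ideal_le_up.
- by move=> l m; exact: free.
- by move=> l m; exact: free.
- by move=> l l' m ll' [u [Gu ul um]]; exists u; split=> //; lia.
- move=> l l' m [u [Gu ul um]] ml; exists u; split=> //.
  by move: ml; rewrite -(submK um) mdegD; lia.
- move=> r m [u [Gu ur um]]; exists u; split=> //.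
  by exists u; split=> //; exact: lepm_refl.
- by move=> l p' q' lq; rewrite -glueE cE; exact: H.
Qed.

Lemma tor_vanish_exp1 (P : free_resolution K n) G c : (forall i, (0 < c i)%N) ->
  (forall k p q, (p + k)%:Z < q ->
     tor_vanish P (ideal_le (bracket_set G c) k) (fun=> False) p q) ->
  forall k p q, (p + k)%:Z < q ->
    tor_vanish P (ideal_le (bracket_set G (fun=> 1%N)) k) (fun=> False) p q.
Proof.
(* In [upd s] the exponents indexed by [s] are already 1; induction on [s] runs up to the list of
   all indices. *)
move=> c_gt0 H; pose upd (s : seq 'I_n) j := if j \in s then 1%N else c j.
have updP s k p q : (p + k)%:Z < q ->
    tor_vanish P (ideal_le (bracket_set G (upd s)) k) (fun=> False) p q.
  elim: s k p q => [|i s IHs]; first exact: H.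
  have -> : upd (i :: s) = set_exp (upd s) i 1.
    by apply/funext => j; rewrite /upd /set_exp inE; case: eqP.
  by apply: tor_vanish_set_exp1 => //; rewrite /upd; case: ifP.
move=> k p q; have -> : (fun=> 1%N) = upd (enum 'I_n).
  by apply/funext => j; rewrite /upd mem_enum.
exact: updP.
Qed.

End ComponentwiseLinear.

Theorem corollary1p3 (K : fieldType) (n : nat) (I : {mpoly K[n]} -> Prop)
    (a : 'I_n -> nat)
    (hI : squarefree_monomial_ideal I)
    (ha : forall i, (0 < a i)%N)
    (hIa : componentwise_linear (bracket_ideal I a)) :
  componentwise_linear I.
Proof.
have [G sqG IG] := hI.
(* As its minimal generators are squarefree, [I] is its own bracket ideal for the exponents
   (1,...,1). *)
have IE : I = monomial_ideal_gen (bracket_set (min_gens I) (fun=> 1%N)).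
  apply/funext => f; apply/propext; rewrite (min_gensE IG).
  suff -> : bracket_set (min_elts G) (fun=> 1%N) = min_elts G.
    exact: min_elts_generators IG f.
  have br1 u : min_elts G u -> bracket_monomial (fun=> 1%N) u = u.
    move=> [/sqG sqGu _]; apply/mnmP => i; rewrite mnmE.
    by have := sqGu i; case: (u i) => [|[]].
  apply/funext => u; apply/propext; split=> [[v Mv ->]|Mu]; first by rewrite br1.
  by exists u; rewrite ?br1.
have reg_a := (componentwise_linear_monomialP K (bracket_set (min_gens I) a)).1 hIa.
rewrite IE; apply/componentwise_linear_monomialP => P.
exact: tor_vanish_exp1 ha (reg_a P).
Qed.
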